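(* If $(\mu_\alpha)$ is $X_0$-exponentially tight with respect to $(t_\alpha)$ and $\mathcal{C}(X)$ separates the points of $X$, then $(\mu_\alpha,t_\alpha)$ has a subnet $(\mu_\beta,t_\beta)$ such that, for any set $\mathcal{A}$ of real-valued continuous functions on $X$ which is either an algebra separating the points or a well-separating class, the following hold. $(\mu_\beta)$ satisfies a large deviation principle with powers $(t_\beta)$ and a rate function $J$ verifying $J(x)=+\infty$ for all $x\in X\setminus\overline{X_0}$ and $$\forall x\in X_0,\quad J(x)=\sup_{h\in\mathcal{A}_{ba}}\{h(x)-\Lambda(h)\}=\sup_{h\in\mathcal{A}}\{h(x)-\overline{\Lambda}(h)\}=\sup_{h\in\mathcal{A}}\{h(x)-\underline{\Lambda}(h)\}=\sup_{h\in\mathcal{A}}\{h(x)-\lim_{M\to+\infty}\underline{\Lambda}(h_M)\},\qquad( * )$$ where $\Lambda,\overline\Lambda,\underline\Lambda$ are taken along the subnet $(\mu_\beta^{t_\beta})$. When $X$ is regular, $( * )$ determines uniquely the rate function by $$\forall x\in X,\quad J(x)=\sup_{G\in\mathcal{G},\,G\ni x}\ \inf_{y\in G\cap X_0}J(y).$$ When $\mathcal{A}$ does not vanish identically at any point of $X$ (in particular when $\mathcal{A}$ contains the constants, as in the well-separating case), $\mathcal{A}_{ba}$ can be replaced by $\mathcal{A}_-$ in $( * )$.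
   Context: $X$ is a topological space, not reduced to one point, in which compact sets are Borel sets; no separation axiom is assumed unless stated (''regular'' does not include Hausdorff). $\mathcal{G}$ is the set of open subsets of $X$; $\mathcal{C}(X)$ (resp. $\mathcal{C}_b(X)$) is the set of real-valued continuous (resp. bounded continuous) functions on $X$. $(\mu_\alpha)$ is a net of Borel probability measures on $X$ and $(t_\alpha)$ a net (same index set) in $]0,+\infty[$ converging to $0$. For a net $(\mu_\beta,t_\beta)$ of this kind write $\mu_\beta^{t_\beta}(A)=(\mu_\beta(A))^{t_\beta}$ for Borel $A$, and for Borel measurable $h:X\to[-\infty,+\infty[$, $\mu_\beta^{t_\beta}(e^{h/t_\beta})=\big(\int_X e^{h(x)/t_\beta}\mu_\beta(dx)\big)^{t_\beta}$. Along $(\mu_\beta^{t_\beta})$: $\overline\Lambda(h)=\log\limsup\mu_\beta^{t_\beta}(e^{h/t_\beta})$, $\underline\Lambda(h)=\log\liminf\mu_\beta^{t_\beta}(e^{h/t_\beta})$, $\Lambda(h)=\log\lim\mu_\beta^{t_\beta}(e^{h/t_\beta})$ when this limit exists (in $[-\infty,+\infty]$ for $\Lambda(h)$); wherever $\Lambda(h)$ appears in the claim, its existence is part of the assertion. Conventions: $e^{-\infty}=0$, $\log0=-\infty$, $\inf\emptyset=+\infty$. Large deviation principle for $(\mu_\beta)$ with powers $(t_\beta)$: for a function $l:X\to[0,+\infty]$, $\limsup\mu_\beta^{t_\beta}(F)\le\sup_{x\in F}e^{-l(x)}$ for all closed $F$ and $\sup_{x\in G}e^{-l(x)}\le\liminf\mu_\beta^{t_\beta}(G)$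 for all open $G$; the lower regularization of $l$ (the greatest lower semi-continuous function $\le l$) is then called a rate function. $X_0$ is the set of $x\in X$ such that for each $G\in\mathcal{G}$ containing $x$, each real $s>0$ and each real $t>0$ there is $h\in\mathcal{C}_b(X)$ with $e^{-t}1_{\{x\}}\le e^h\le1_G\vee e^{-s}$. $(\mu_\alpha)$ is $X_0$-exponentially tight with respect to $(t_\alpha)$ if for each $\varepsilon>0$ there is a compact set $K\subset X_0$ with $\limsup\mu_\alpha^{t_\alpha}(X\setminus K)<\varepsilon$. Algebras are real algebras under pointwise operations, not necessarily unital. A set $\mathcal{A}\subset\mathcal{C}(X)$ separates the points if for all $x\neq y$ there is $h\in\mathcal{A}$ with $h(x)\ne h(y)$; it does not vanish identically at any point if for every $x$ there is $h\in\mathcal{A}$ with $h(x)\neq0$. A well-separating class is a set $\mathcal{A}\subset\mathcal{C}(X)$ which contains the constants, is closed under finite pointwise minima, and such that for all $x\neq y$ in $X$ and $a,b\in\mathbb{R}$ there is $g\in\mathcal{A}$ with $g(x)=a$, $g(y)=b$. $\mathcal{A}_{ba}$ is the set of bounded-above elements of $\mathcal{A}$ and $\mathcal{A}_-=\{h\in\mathcal{A}:h\le0\}$. For real $M$, $h_M=h1_{\{h<M\}}-\infty1_{\{h\ge M\}}$ (i.e. $h_M=h$ on $\{h<M\}$ and $-\infty$ elsewhere). *)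

(* Defs.v *)
(* MathComp-Analysis *)
From HB Require Import structures.
From mathcomp Require Import all_boot all_order all_algebra.
From mathcomp Require Import all_classical all_reals all_analysis.
Import Order.TTheory GRing.Theory Num.Theory.
Import numFieldNormedType.Exports.

Set Implicit Arguments.
Unset Strict Implicit.
Unset Printing Implicit Defensive.

Local Open Scope classical_set_scope.
Local Open Scope ring_scope.
Local Open Scope ereal_scope.

(* The library requires a [pointedType] here, hence [ptopologicalType] below;
   a space carrying a probability measure is nonempty anyway. *)
Notation borel X := (g_sigma_algebraType (@open X)).

Record directed_set (I : Type) (le : I -> I -> Prop) : Prop := DirectedSet {
  directed_nonempty : exists i : I, True ;
  directed_refl : forall i, le i i ;
  directed_trans : forall i j k, le i j -> le j k -> le i k ;
  directed_ub : forall i j, exists k, le i k /\ le j k }.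

(* [phi] presents [u \o phi] as a subnet (in the sense of Kelley: no
   monotonicity is required of [phi]) of any net [u] indexed by [(I, leI)]. *)
Definition subnet_map (I : Type) (leI : I -> I -> Prop)
    (B : Type) (leB : B -> B -> Prop) (phi : B -> I) : Prop :=
  directed_set leB /\
  forall i0, exists b0, forall b, leB b0 b -> leI i0 (phi b).

Definition tails (I : Type) (le : I -> I -> Prop) : set_system I :=
  filter_from setT (fun i => [set j | le i j]).

(* The library's [limf_esup] and [limf_einf] need a [filteredType] structure
   on the index type, which an arbitrary directed set does not carry. *)
Definition net_limsup (R : realType) (I : Type) (le : I -> I -> Prop)
    (u : I -> \bar R) : \bar R :=
  ereal_inf [set ereal_sup (u @` [set j | le i j]) | i in setT].

Definition net_liminf (R : realType) (I : Type) (le : I -> I -> Prop)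
    (u : I -> \bar R) : \bar R :=
  ereal_sup [set ereal_inf (u @` [set j | le i j]) | i in setT].

Definition measure_pow (R : realType) (X : ptopologicalType)
    (mu : probability (borel X) R) (t : R) (A : set X) : \bar R :=
  mu A `^ t.

Definition exp_integral_pow (R : realType) (X : ptopologicalType)
    (mu : probability (borel X) R) (t : R) (h : X -> \bar R) : \bar R :=
  (\int[mu]_(x in setT) expeR (h x * (t^-1)%:E)) `^ t.

Definition Lambda_sup (R : realType) (X : ptopologicalType)
    (I : Type) (le : I -> I -> Prop)
    (mu : I -> probability (borel X) R) (t : I -> R) (h : X -> \bar R) :
    \bar R :=
  lne (net_limsup le (fun i => exp_integral_pow (mu i) (t i) h)).

Definition Lambda_inf (R : realType) (X : ptopologicalType)
    (I : Type) (le : I -> I -> Prop)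
    (mu : I -> probability (borel X) R) (t : I -> R) (h : X -> \bar R) :
    \bar R :=
  lne (net_liminf le (fun i => exp_integral_pow (mu i) (t i) h)).

(* Meaningful only when [Lambda_exists] holds, as [lim] is a total operator. *)
Definition Lambda (R : realType) (X : ptopologicalType)
    (I : Type) (le : I -> I -> Prop)
    (mu : I -> probability (borel X) R) (t : I -> R) (h : X -> \bar R) :
    \bar R :=
  lne (lim ((fun i => exp_integral_pow (mu i) (t i) h) @ tails le)).

Definition Lambda_exists (R : realType) (X : ptopologicalType)
    (I : Type) (le : I -> I -> Prop)
    (mu : I -> probability (borel X) R) (t : I -> R) (h : X -> \bar R) : Prop :=
  cvg ((fun i => exp_integral_pow (mu i) (t i) h) @ tails le).

(* The supremum is taken in [0, +oo], so that it is 0 on the empty set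
   (whereas [ereal_sup set0 = -oo]). *)
Definition sup_exp (R : realType) (X : ptopologicalType)
    (l : X -> \bar R) (A : set X) : \bar R :=
  maxe 0 (ereal_sup [set expeR (- l x) | x in A]).

Definition large_deviation_principle (R : realType) (X : ptopologicalType)
    (I : Type) (le : I -> I -> Prop)
    (mu : I -> probability (borel X) R) (t : I -> R) (l : X -> \bar R) : Prop :=
  [/\ forall x, 0 <= l x,
      forall F : set X, closed F ->
        net_limsup le (fun i => measure_pow (mu i) (t i) F) <= sup_exp l F &
      forall G : set X, open G ->
        sup_exp l G <= net_liminf le (fun i => measure_pow (mu i) (t i) G)].

Definition lower_regularization (R : realType) (X : ptopologicalType)
    (l J : X -> \bar R) : Prop :=
  [/\ lower_semicontinuous J, forall x, J x <= l x &
      forall k : X -> \bar R, lower_semicontinuous k ->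
        (forall x, k x <= l x) -> forall x, k x <= J x].

Definition rate_function (R : realType) (X : ptopologicalType)
    (I : Type) (le : I -> I -> Prop)
    (mu : I -> probability (borel X) R) (t : I -> R) (J : X -> \bar R) : Prop :=
  exists l : X -> \bar R,
    large_deviation_principle le mu t l /\ lower_regularization l J.

Definition X0 (R : realType) (X : ptopologicalType) : set X :=
  [set x | forall (G : set X) (s t : R), open G -> G x ->
    (0 < s)%R -> (0 < t)%R ->
    exists h : X -> R, [/\ continuous h, bounded_fun h &
      forall y, (expR (- t) * \1_[set x] y <= expR (h y)
                 <= Num.max (\1_G y) (expR (- s)))%R]].
Arguments X0 R X : clear implicits.

Definition X0_exponentially_tight (R : realType) (X : ptopologicalType)
    (I : Type) (le : I -> I -> Prop)
    (mu : I -> probability (borel X) R) (t : I -> R) : Prop :=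
  forall eps : R, (0 < eps)%R -> exists K : set X,
    [/\ compact K, K `<=` X0 R X &
        net_limsup le (fun i => measure_pow (mu i) (t i) (~` K)) < eps%:E].

Definition separates_points (R : realType) (X : ptopologicalType)
    (A : set (X -> R)) : Prop :=
  forall x y : X, x <> y -> exists2 h, A h & h x <> h y.

(* Not necessarily unital. *)
Record function_algebra (R : realType) (X : ptopologicalType)
    (A : set (X -> R)) : Prop := FunctionAlgebra {
  function_algebra_cont : forall h, A h -> continuous h ;
  function_algebra0 : A (fun=> 0%R) ;
  function_algebraD : forall f g, A f -> A g -> A (fun x => f x + g x)%R ;
  function_algebraZ : forall (c : R) f, A f -> A (fun x => c * f x)%R ;
  function_algebraM : forall f g, A f -> A g -> A (fun x => f x * g x)%R }.

Record well_separating_class (R : realType) (X : ptopologicalType)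
    (A : set (X -> R)) : Prop := WellSeparatingClass {
  well_separating_cont : forall h, A h -> continuous h ;
  well_separating_cst : forall c : R, A (fun=> c) ;
  well_separating_min : forall f g, A f -> A g ->
    A (fun x => Num.min (f x) (g x)) ;
  well_separating_interp : forall x y : X, x <> y -> forall a b : R,
    exists g, [/\ A g, g x = a & g y = b] }.

Definition nowhere_vanishing (R : realType) (X : ptopologicalType)
    (A : set (X -> R)) : Prop :=
  forall x : X, exists2 h, A h & h x <> 0%R.

Definition bounded_above (R : realType) (X : ptopologicalType)
    (A : set (X -> R)) : set (X -> R) :=
  [set h | A h /\ exists M : R, forall x, (h x <= M)%R].

Definition nonpositive (R : realType) (X : ptopologicalType)
    (A : set (X -> R)) : set (X -> R) :=
  [set h | A h /\ forall x, (h x <= 0)%R].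

Definition truncation (R : realType) (X : ptopologicalType)
    (h : X -> R) (M : R) : X -> \bar R :=
  fun x => if (h x < M)%R then (h x)%:E else -oo.

(* [C] is the class over which the first supremum, the one involving
   [Lambda], is taken. *)
Definition rate_formula (R : realType) (X : ptopologicalType)
    (I : Type) (le : I -> I -> Prop)
    (mu : I -> probability (borel X) R) (t : I -> R)
    (C A : set (X -> R)) (J : X -> \bar R) : Prop :=
  [/\ forall h, C h -> Lambda_exists le mu t (EFin \o h),
      forall h, A h ->
        cvg (Lambda_inf le mu t (truncation h M) @[M --> +oo%R]) &
      forall x, X0 R X x ->
        [/\ J x = ereal_sup
              [set (h x)%:E - Lambda le mu t (EFin \o h) | h in C],
            J x = ereal_sup
              [set (h x)%:E - Lambda_sup le mu t (EFin \o h) | h in A],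
            J x = ereal_sup
              [set (h x)%:E - Lambda_inf le mu t (EFin \o h) | h in A] &
            J x = ereal_sup
              [set (h x)%:E
                   - lim (Lambda_inf le mu t (truncation h M) @[M --> +oo%R])
              | h in A]]].

(* Main.v *)
(* Along a universal subnet every net of extended reals has a limit; write
   gam(A) for the limit of mu^t(A).  As t -> 0, gam is maxitive, so compactness
   and tightness show that J(x) = - log inf_{G open, x in G} gam(G) satisfies
   the large deviation principle, with gam(F) <= sup_{F /\ X0} e^{-J} for closed
   F; in a regular space the closed neighbourhoods then identify J.

   The inequality h(x) - Lambda(h_M) <= J(x) for M > h(x) comes from restricting
   the integral to {h(x) - e < h < M}.  For the converse no density theorem is
   needed.  Given c < J(x), pick an open G containing x with gam(G) < e^{-c} and
   a compact K with gam(X \ K) < e^{-c}; it is enough to find f <= 0 with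
   f(x) = 0 and f <= -c on the compact set K \ G, such that f is in A up to a
   constant.  By compactness f is a finite sum of functions - lam (g - g(x))^2,
   of functions - lam (k (g - g(x)))^2 when A vanishes nowhere, or a finite
   minimum in the well-separating case. *)
Require Import Defs.
From HB Require Import structures.
From mathcomp Require Import all_boot all_order all_algebra.
From mathcomp Require Import all_classical all_reals all_analysis.
From mathcomp Require Import measurable_realfun ring lra.
Set Implicit Arguments.
Unset Strict Implicit.
Unset Printing Implicit Defensive.

Import Order.TTheory GRing.Theory Num.Theory.
Import numFieldNormedType.Exports.
Local Open Scope classical_set_scope.
Local Open Scope ring_scope.
Local Open Scope ereal_scope.

(** * Limits of extended reals along nets and universal subnets *)

Definition universal_net (I : Type) (le : I -> I -> Prop) (T : Type)
    (phi : I -> T) : Prop :=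
  forall P : set T, (\forall i \near tails le, P (phi i)) \/
                    (\forall i \near tails le, ~ P (phi i)).

Section nets.
Context {R : realType} {I : Type} {le : I -> I -> Prop}.
Hypothesis hI : directed_set le.

Lemma tails_proper : ProperFilter (tails le).
Proof.
case: hI => -[i0 _] lexx le_trans le_ub; apply: filter_from_proper.
  apply: filter_from_filter; first by exists i0.
  move=> i j _ _; have [k [ik jk]] := le_ub i j.
  by exists k => // l kl; split; [exact: le_trans kl|exact: le_trans kl].
by move=> i _; exists i; exact: lexx.
Qed.

Lemma net_limsup_le (u : I -> \bar R) a :
  (\forall i \near tails le, u i <= a) -> net_limsup le u <= a.
Proof.
move=> [i0 _ h]; apply: ge_ereal_inf.
by exists (ereal_sup (u @` [set j | le i0 j])); [exists i0|apply: ge_ereal_sup => _ [j /h ? <-]].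
Qed.

Lemma net_limsup_lt (u : I -> \bar R) a :
  net_limsup le u < a -> \forall i \near tails le, u i < a.
Proof.
move=> /ereal_inf_lt[_ [i0 _ <-] lta]; exists i0 => // j ij.
by apply: le_lt_trans lta; apply: ereal_sup_ubound; exists j.
Qed.

Lemma net_liminf_ge (u : I -> \bar R) a :
  (\forall i \near tails le, a <= u i) -> a <= net_liminf le u.
Proof.
move=> [i0 _ h]; apply: le_ereal_sup_tmp.
by exists (ereal_inf (u @` [set j | le i0 j])); [exists i0|apply: le_ereal_inf_tmp => _ [j /h ? <-]].
Qed.

Lemma net_liminf_gt (u : I -> \bar R) a :
  a < net_liminf le u -> \forall i \near tails le, a < u i.
Proof.
move=> /ereal_sup_gt[_ [i0 _ <-] lta]; exists i0 => // j ij.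
by apply: (lt_le_trans lta); apply: ereal_inf_lbound; exists j.
Qed.

(** Most estimates below begin here: when y is a limsup, the strict inequality y < d with d real
    becomes an eventual inequality through [net_limsup_lt], and infinite values need no separate
    treatment. *)
Lemma le_dense_EFin (x y : \bar R) :
  (forall d : R, y < d%:E -> x <= d%:E) -> x <= y.
Proof.
move=> h; rewrite leNgt; apply/negP => yx.
have [d yd dx] : exists2 d : R, y < d%:E & d%:E < x.
  move: y x yx {h} => [y| |] [x| |]//=.
  - rewrite lte_fin => yx; exists ((x + y) / 2)%R; rewrite lte_fin; lra.
  - by move=> _; exists (y + 1)%R; rewrite ?ltry// lte_fin; lra.
  - by move=> _; exists (x - 1)%R; rewrite ?ltNyr// lte_fin; lra.
  - by move=> _; exists 0%R; rewrite ?ltry ?ltNyr.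
by have := h _ yd; rewrite leNgt dx.
Qed.

Lemma net_limsupS (u v : I -> \bar R) :
  (\forall i \near tails le, u i <= v i) -> net_limsup le u <= net_limsup le v.
Proof.
have FF := tails_proper.
move=> uv; apply: le_dense_EFin => d /net_limsup_lt ltd.
apply: net_limsup_le; apply: filterS2 uv ltd => i /le_trans + /ltW; exact.
Qed.

Lemma net_liminf_le_limsup (u : I -> \bar R) :
  net_liminf le u <= net_limsup le u.
Proof.
have FF := tails_proper.
apply: le_dense_EFin => d /net_limsup_lt ltd.
rewrite leNgt; apply/negP => /net_liminf_gt gtd.
have /filter_ex[i [/lt_trans/[apply]]] :
    \forall i \near tails le, u i < d%:E /\ d%:E < u i by near do split.
by rewrite ltxx.
Unshelve. all: by end_near.
Qed.

Section universal.
Context {T : Type} {phi : I -> T}.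
Hypothesis phi_universal : universal_net le phi.

(** For a real d strictly between the liminf and the limsup, the condition u < d would neither hold
    eventually nor fail eventually, against universality. *)
Lemma universal_limsup_le_liminf (u : T -> \bar R) :
  net_limsup le (fun i => u (phi i)) <= net_liminf le (fun i => u (phi i)).
Proof.
have FF := tails_proper.
apply: le_dense_EFin => d ltd; rewrite leNgt; apply/negP => gtd.
have [lt|nlt] := phi_universal [set z | u z < d%:E].
  move: gtd; rewrite ltNge => /negP; apply.
  by apply: net_limsup_le; apply: filterS lt => i /ltW.
move: ltd; rewrite ltNge => /negP; apply.
by apply: net_liminf_ge; apply: filterS nlt => i /= /negP; rewrite -leNgt.
Qed.

Lemma universal_liminf (u : T -> \bar R) :
  net_liminf le (fun i => u (phi i)) = net_limsup le (fun i => u (phi i)).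
Proof.
by apply/eqP; rewrite eq_le net_liminf_le_limsup universal_limsup_le_liminf.
Qed.

Lemma universal_cvg (u : T -> \bar R) :
  (fun i => u (phi i)) @ tails le --> net_limsup le (fun i => u (phi i)).
Proof.
have FF := tails_proper.
(* A neighbourhood contains an interval with open or missing ends. The left end is controlled by the
   liminf, equal here to the limsup, and the right end by the limsup; a missing end imposes
   nothing. *)
move=> A; rewrite itv_nbhsE => -[[l r] [ends + sub]].
rewrite in_itv/= => /andP[hl hr].
suff : \forall i \near tails le, u (phi i) \in Interval l r.
  by apply: filterS => i ui; apply: sub.
have Hl : \forall i \near tails le, (l <= BLeft (u (phi i)))%O.
  case: l ends hl {sub} => [b l|b].
    move=> /itv_open_ends_lside ->; rewrite -universal_liminf.
    by move=> /net_liminf_gt; exact: filterS.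
  by move=> /itv_open_ends_linfty -> _; near=> i.
have Hr : \forall i \near tails le, (BRight (u (phi i)) <= r)%O.
  case: r ends hr {sub} => [b r|b].
    by move=> /itv_open_ends_rside -> /net_limsup_lt; exact: filterS.
  by move=> /itv_open_ends_rinfty -> _; near=> i.
by apply: filterS2 Hl Hr => i a b; rewrite itv_boundlr a b.
Unshelve. all: by end_near. Qed.

End universal.
End nets.

(* The whole [tails leB] need not be an ultrafilter, only its image under
   [phi], hence the form of [universal_net]. *)
Lemma universal_subnet (I : Type) (le : I -> I -> Prop) : directed_set le ->
  exists (B : Type) (leB : B -> B -> Prop) (phi : B -> I),
    subnet_map le leB phi /\ universal_net leB phi.
Proof.
move=> hI; have FF := tails_proper hI.
have [U [UU tailsU]] := ultraFilterLemma FF.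
have UF := @ultra_proper _ _ UU.
(* Indices are pairs (i, S) with i in S and S in the ultrafilter, ordered by reverse inclusion of
   the sets. Thus [phi] eventually lies in each set of [U], and [U] contains every set or its
   complement. *)
pose B := {p : I * set I | U p.2 /\ p.2 p.1}.
pose leB (b c : B) := (sval c).2 `<=` (sval b).2.
pose phi (b : B) := (sval b).1.
have point S : U S -> exists b : B, (sval b).2 = S.
  move=> US; have [i Si] := filter_ex US.
  by exists (exist (fun p : I * set I => U p.2 /\ p.2 p.1) (i, S) (conj US Si)).
have near_of S : U S -> \forall b \near tails leB, S (phi b).
  move=> US; have [b0 b0S] := point _ US; exists b0 => // b.
  by rewrite /leB/= b0S; apply; case: (svalP b).
exists B, leB, phi; split; [split; [split|]|].
- by have [b _] := point _ (@filterT _ U _); exists b.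
- by move=> b.
- by move=> b c d bc cd; apply: subset_trans bc.
- move=> b c; have [d dE] : exists d : B, (sval d).2 = (sval b).2 `&` (sval c).2.
    by apply/point/filterI; [case: (svalP b)|case: (svalP c)].
  by exists d; rewrite /leB dE; split; [exact: subIsetl|exact: subIsetr].
- move=> i0; have /near_of[b0 _ h] : U [set j | le i0 j].
    by apply: tailsU; exists i0.
  by exists b0.
- move=> P; have [UP|UnP] := in_ultra_setVsetC P UU.
    by left; exact: (near_of P).
  by right; exact: (near_of (~` P)).
Qed.

Lemma subnet_tails (I : Type) (le : I -> I -> Prop) (B : Type)
    (leB : B -> B -> Prop) (phi : B -> I) :
  subnet_map le leB phi -> phi @ tails leB `=>` tails le.
Proof.
move=> [_ cof] P [i0 _ iP]; have [b0 hb0] := cof i0.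
by exists b0 => // b /hb0 /iP.
Qed.

Lemma subnet_limsup (R : realType) (I : Type) (le : I -> I -> Prop) (B : Type)
    (leB : B -> B -> Prop) (phi : B -> I) (u : I -> \bar R) :
  subnet_map le leB phi -> net_limsup leB (u \o phi) <= net_limsup le u.
Proof.
move=> sub; apply: le_dense_EFin => d /net_limsup_lt ltd; apply: net_limsup_le.
have [hB _] := sub; have FF := tails_proper hB.
apply: (@filterS _ (tails leB) _ _ _ _ (subnet_tails sub ltd)) => b; exact: ltW.
Qed.

(** * Powers with exponents tending to 0 *)

Section power_limits.
Context {R : realType} {I : Type} {le : I -> I -> Prop} {t : I -> R}.
Hypotheses (hI : directed_set le) (t_gt0 : forall i, (0 < t i)%R).
Hypothesis t_cvg : t @ tails le --> (0 : R)%R.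

Lemma poweR_le (r : R) (x y : \bar R) :
  (0 < r)%R -> 0 <= x -> x <= y -> x `^ r <= y `^ r.
Proof.
move=> r0 x0 xy; apply: gt0_ler_poweR => //; first exact: ltW.
  by rewrite in_itv/= x0 leey.
by rewrite in_itv/= (le_trans x0 xy) leey.
Qed.

Lemma near_pow2_le (r : R) : (1 < r)%R ->
  \forall i \near tails le, (2 `^ t i <= r)%R.
Proof.
move=> r1; have FF := tails_proper hI.
have l2 : (0 < ln (2 : R))%R by rewrite ln_gt0// ltr1n.
have lr : (0 < ln r)%R by exact: ln_gt0.
have : (0 < ln r / ln 2)%R by rewrite divr_gt0.
move=> /(cvgr_lt (0 : R)%R t_cvg); apply: filterS => i; rewrite ltr_pdivlMr// => lt.
rewrite /powR pnatr_eq0/= -[leRHS](@lnK R) ?posrE ?ler_expR; first exact: ltW.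
by apply: lt_trans r1.
Qed.

(* (x + y)^t <= 2^t max(x^t, y^t), and 2^t tends to 1. *)
Lemma limsup_pow_max (a b c : I -> \bar R) :
  (forall i, 0 <= a i) -> (forall i, 0 <= b i) -> (forall i, 0 <= c i) ->
  (forall i, c i <= a i + b i) ->
  net_limsup le (fun i => c i `^ t i) <=
  maxe (net_limsup le (fun i => a i `^ t i))
       (net_limsup le (fun i => b i `^ t i)).
Proof.
have FF := tails_proper hI.
move=> a0 b0 c0 cab; apply: le_dense_EFin => d; rewrite gt_max => /andP[ad bd].
have pow_limsup_ge0 (u : I -> \bar R) : 0 <= net_limsup le (fun i => u i `^ t i).
  rewrite leNgt; apply/negP => /(net_limsup_lt)/filter_ex[i].
  by rewrite ltNge poweR_ge0.
(* Taking r strictly between both limsups and d leaves room for the factor 2^t, which is eventually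
   at most d / r. Positivity of r comes from the midpoint of a nonnegative maximum and the larger
   d. *)
have [r [r0 rd ar br]] : exists r : R, [/\ (0 < r)%R, (r < d)%R,
    net_limsup le (fun i => a i `^ t i) < r%:E &
    net_limsup le (fun i => b i `^ t i) < r%:E].
  move: ad bd (pow_limsup_ge0 a) (pow_limsup_ge0 b).
  case: (net_limsup le (fun i => a i `^ t i)) => [x| |]//.
  case: (net_limsup le (fun i => b i `^ t i)) => [y| |]//.
  rewrite !lte_fin !lee_fin => xd yd x0 y0.
  exists ((Num.max x y + d) / 2)%R; rewrite !lte_fin.
  by have [xy|xy] := leP x y; split; lra.
have := near_pow2_le (r := d / r); rewrite ltr_pdivlMr// mul1r => /(_ rd) near2.
apply: net_limsup_le.
apply: filterS3 (near2) (net_limsup_lt ar) (net_limsup_lt br) => i h2 ha hb.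
have main (m : \bar R) : 0 <= m -> c i <= 2%:E * m -> m `^ t i < r%:E -> c i `^ t i <= d%:E.
  move=> m0 cm mr; apply: (le_trans (poweR_le (t_gt0 i) (c0 i) cm)).
  rewrite poweRM// poweR_EFin.
  apply: (@le_trans _ _ ((d / r)%:E * r%:E)).
    by apply: lee_pmul; rewrite ?poweR_ge0 ?lee_fin ?powR_ge0// ltW.
  by rewrite -EFinM divfK// gt_eqF.
have [ab|/ltW ba] := leP (a i) (b i).
- apply: (main (b i)) => //; apply: (le_trans (cab i)).
  by rewrite mule_natl mule2n leeD2r.
- apply: (main (a i)) => //; apply: (le_trans (cab i)).
  by rewrite mule_natl mule2n leeD2l.
Qed.

End power_limits.

(** * Compactness and peak functions *)

(** If P K failed, the sets whose complement in K satisfies P would form a proper filter containing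
    K. At a cluster point of it in K, a neighbourhood V satisfying P would have to meet its own
    complement, which belongs to the filter. *)
Lemma compact_ind (X : topologicalType) (P : set X -> Prop) (K : set X) :
  compact K -> P set0 ->
  (forall A B, A `<=` B -> P B -> P A) ->
  (forall A B, P A -> P B -> P (A `|` B)) ->
  (forall x, K x -> exists2 V, nbhs x V & P V) -> P K.
Proof.
move=> cK P0 PS PU Ploc; apply: contrapT => nPK.
pose F : set_system X := [set A | P (K `&` ~` A)].
have FF : ProperFilter F.
  apply: Build_ProperFilter_ex.
    move=> A FA; apply: contrapT => /forallNP nA; apply/nPK/(PS _ _ _ FA).
    by move=> x Kx; split => //; exact: nA.
  split; rewrite /F/=.
  - by rewrite setCT setI0.
  - move=> A B PA PB; apply: PS (PU _ _ PA PB).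
    by move=> x [Kx /not_andP[nA|nB]]; [left|right].
  - by move=> A B AB; apply: PS; apply: setIS; exact: subsetC.
have [|x [Kx clx]] := cK F _.
  by rewrite /F/= setICr.
have [V xV PV] := Ploc _ Kx.
have [] := clx (~` V) V _ xV.
  by apply: PS PV => y [_]; rewrite setCK.
by move=> y [].
Qed.

(* The constants [C] are there because an algebra need not contain the
   constants: [h x - Lambda h] does not change when a constant is added to [h]. *)
Definition peak_family (R : realType) (X : ptopologicalType) (x : X)
    (T D : set (X -> R)) : Prop :=
  [/\ D !=set0,
      forall f, D f -> [/\ continuous f, forall y, (f y <= 0)%R & f x = 0%R],
      forall f g, D f -> D g ->
        exists2 k, D k & forall y, (k y <= f y)%R /\ (k y <= g y)%R,
      forall y (s : R), y <> x -> exists2 f, D f & (f y < - s)%R &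
      forall f, D f -> exists C : R, T (fun y => f y + C)%R].

Section peaks.
Context {R : realType} {X : ptopologicalType}.
Implicit Types (A T D : set (X -> R)) (x y : X).

Lemma peak_familyS x T T' D :
  T `<=` T' -> peak_family x T D -> peak_family x T' D.
Proof.
by move=> TT' [? ? ? ? DT]; split=> // f /DT[C /TT']; exists C.
Qed.

(** Continuity spreads the bound at one point to a neighbourhood, and common lower bounds in [D]
    make the property stable under unions, so [compact_ind] applies. *)
Lemma compact_peak x T D (K : set X) (s : R) : peak_family x T D ->
  compact K -> ~ K x -> exists2 f, D f & forall y, K y -> (f y <= - s)%R.
Proof.
move=> [[f0 Df0] Dprop Dmeet Dfar _] cK nKx.
pose P B := exists2 f, D f & forall y, B y -> (f y <= - s)%R.
apply: (@compact_ind _ P) => //.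
- by exists f0.
- by move=> A B AB [f Df fB]; exists f => // y /AB /fB.
- move=> A B [f Df fA] [g Dg gB]; have [k Dk kfg] := Dmeet _ _ Df Dg.
  exists k => // y [/fA|/gB]; apply: le_trans; by have [] := kfg y.
- move=> y Ky; have [|f Df fy] := Dfar y s; first by move=> yx; apply: nKx; rewrite -yx.
  have [cf _ _] := Dprop _ Df.
  exists [set z | (f z < - s)%R]; last by exists f => // z /ltW.
  exact: (cvgr_lt (f y) (cf y)).
Qed.

Definition nonpositive_at x A : set (X -> R) :=
  [set f : X -> R | [/\ A f, forall y, (f y <= 0)%R & f x = 0%R]].

Definition shifted_at x A : set (X -> R) :=
  [set f : X -> R | [/\ continuous f, forall y, (f y <= 0)%R, f x = 0%R &
               exists C : R, A (fun y => f y + C)%R]].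

Lemma continuous_cstM_sqr (c : R) (v : X -> R) :
  continuous v -> continuous (fun y => - (c * v y ^+ 2))%R.
Proof.
move=> cv y; apply: cvgN; apply: cvgM; first exact: cvg_cst.
by apply: cvgM; exact: cv.
Qed.

Lemma exists_scale_lt (v s : R) : v != 0%R ->
  exists2 c : R, (0 <= c)%R & (- (c * v ^+ 2) < - s)%R.
Proof.
move=> v0; have v2 : (0 < v ^+ 2)%R by rewrite exprn_even_gt0.
(* With this c the product c v^2 equals |s| + 1, which exceeds s whatever its sign. *)
exists ((`|s| + 1) / v ^+ 2)%R; first by rewrite divr_ge0 ?ltW// ler_wpDl.
rewrite ltrN2 divfK ?gt_eqF//; have := ler_norm s; lra.
Qed.

(** Since the functions are nonpositive, a sum lies below each of its terms; it replaces the
    minimum, under which an algebra need not be closed. *)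
Lemma algebra_peak_bounded_above x A : function_algebra A ->
  separates_points A -> peak_family x (bounded_above A) (shifted_at x A).
Proof.
move=> [Acont A0 AD AZ AM] Asep; split.
- exists (fun=> 0%R); split => //; first by move=> y; exact: cvg_cst.
  by exists 0%R; under eq_fun do rewrite addr0.
- by move=> f [].
- move=> f g [cf f0 fx [C AC]] [cg g0 gx [C' AC']].
  exists (fun y => f y + g y)%R; last first.
    by move=> y; have := f0 y; have := g0 y; split; lra.
  split.
  + by move=> y; apply: cvgD; [exact: cf|exact: cg].
  + by move=> y; have := f0 y; have := g0 y; lra.
  + by rewrite fx gx addr0.
  + exists (C + C')%R.
    have -> : (fun y => f y + g y + (C + C'))%R =
              (fun y => (f y + C) + (g y + C'))%R by apply/funext => y; ring.
    exact: AD.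
- move=> y s yx; have [g Ag gxy] := Asep _ _ yx.
  have [|c c0 cs] := @exists_scale_lt (g y - g x)%R s.
    by rewrite subr_eq0; apply/eqP.
  exists (fun z => - (c * (g z - g x) ^+ 2))%R => //; split.
  + apply: (@continuous_cstM_sqr c (fun z => g z - g x)%R) => z.
    by apply: cvgB; [exact: Acont|exact: cvg_cst].
  + by move=> z; rewrite oppr_le0 mulr_ge0// sqr_ge0.
  + by rewrite subrr expr0n mulr0 oppr0.
  (* This constant cancels the constant term of the expanded square; what remains is a combination
     of g^2 and g, hence in [A]. *)
  + exists (c * g x ^+ 2)%R.
    have -> : (fun z => - (c * (g z - g x) ^+ 2) + c * g x ^+ 2)%R =
              (fun z => (- c) * (g z * g z) + (2 * c * g x) * g z)%R.
      by apply/funext => z; ring.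
    by apply: AD; apply: AZ => //; exact: AM.
- move=> f [_ f0 _ [C AC]]; exists C; split => //.
  by exists C => y; have := f0 y; lra.
Qed.

Lemma nonpositive_at_target x A f : nonpositive_at x A f ->
  exists C : R, nonpositive A (fun y => f y + C)%R.
Proof.
by move=> [Af f0 _]; exists 0%R; under eq_fun do rewrite addr0; split.
Qed.

Lemma algebra_peak_nonpositive x A : function_algebra A ->
  separates_points A -> nowhere_vanishing A ->
  peak_family x (nonpositive A) (nonpositive_at x A).
Proof.
move=> [Acont A0 AD AZ AM] Asep Anv; split.
- by exists (fun=> 0%R).
- by move=> f [/Acont].
- move=> f g [Af f0 fx] [Ag g0 gx].
  exists (fun y => f y + g y)%R; last first.
    by move=> y; have := f0 y; have := g0 y; split; lra.
  split; [exact: AD| |by rewrite fx gx addr0].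
  by move=> y; have := f0 y; have := g0 y; lra.
- move=> y s yx; have [g Ag gxy] := Asep _ _ yx.
  have [k Ak ky] := Anv y.
  (* [v] vanishes at [x] but not at [y], and lies in [A] without constants. *)
  pose v z := (k z * (g z - g x))%R.
  have Av : A v.
    have -> : v = (fun z => k z * g z + (- g x) * k z)%R.
      by apply/funext => z; rewrite /v; ring.
    by apply: AD; [exact: AM|exact: AZ].
  have [|c c0 cs] := @exists_scale_lt (v y) s.
    by rewrite mulf_neq0//; [exact/eqP|rewrite subr_eq0; apply/eqP].
  exists (fun z => - (c * v z ^+ 2))%R => //; split.
  + have -> : (fun z => - (c * v z ^+ 2))%R = (fun z => (- c) * (v z * v z))%R.
      by apply/funext => z; ring.
    by apply: AZ; exact: AM.
  + by move=> z; rewrite oppr_le0 mulr_ge0// sqr_ge0.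
  + by rewrite /v subrr mulr0 expr0n mulr0 oppr0.
- exact: nonpositive_at_target.
Qed.

Lemma well_separating_peak x A : well_separating_class A ->
  peak_family x (nonpositive A) (nonpositive_at x A).
Proof.
move=> [Acont Acst Amin Ainterp]; split.
- by exists (fun=> 0%R); split.
- by move=> f [/Acont].
- move=> f g [Af f0 fx] [Ag g0 gx].
  exists (fun y => Num.min (f y) (g y)); last first.
    by move=> y; rewrite !ge_min !lexx orbT.
  split; [exact: Amin| |by rewrite fx gx minxx].
  by move=> y; rewrite ge_min f0.
(* The value - s - 1 gives the strict bound at y; the minimum with the constant 0 then makes the
   function nonpositive and keeps its value 0 at x. *)
- move=> y s yx; have [g [Ag gx gy]] := Ainterp _ _ (nesym yx) 0%R (- s - 1)%R.
  exists (fun z => Num.min (g z) 0)%R; last by rewrite gt_min gy; apply/orP; left; lra.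
  split; [exact: Amin| |by rewrite gx minxx].
  by move=> z; rewrite ge_min lexx orbT.
- exact: nonpositive_at_target.
Qed.

End peaks.

(** * Borel measurability and bounds on integrals *)

Section borel_integrals.
Context {R : realType} {X : ptopologicalType}.

Lemma open_measurable_borel (G : set X) : open G -> measurable (G : set (borel X)).
Proof. exact: sub_gen_smallest. Qed.

Lemma continuous_measurable_borel (h : X -> R) :
  continuous h -> measurable_fun setT (h : borel X -> R).
Proof.
move=> /continuousP ch.
apply: (measurability _ (@RGenOpens.measurableE R)).
move=> _ [_ [a [b ->]] <-]; rewrite setTI.
apply: open_measurable_borel; apply: ch; exact: interval_open.
Qed.

Lemma measurable_expR_scale (h : X -> R) (c : R) : continuous h ->
  measurable_fun setT (fun x : borel X => (expR (h x * c))%:E).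
Proof.
move=> ch; apply/measurable_EFinP; apply: measurableT_comp.
  exact: measurable_expR.
apply: measurable_funM => //; exact: continuous_measurable_borel.
Qed.

Lemma expeR_truncation (h : X -> R) (M c : R) x : (0 < c)%R ->
  expeR (truncation h M x * c%:E) = if (h x < M)%R then (expR (h x * c))%:E else 0.
Proof.
by move=> c0; rewrite /truncation; case: ifP => // _; rewrite gt0_mulNye ?lte_fin.
Qed.

Lemma measurable_expeR_truncation (h : X -> R) (M c : R) :
  continuous h -> (0 < c)%R ->
  measurable_fun setT (fun x : borel X => expeR (truncation h M x * c%:E)).
Proof.
move=> ch c0; under eq_fun do rewrite expeR_truncation//.
apply: measurable_fun_ifT => //; last exact: measurable_expR_scale.
by apply: measurable_fun_ltr => //; exact: continuous_measurable_borel.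
Qed.

Lemma integral_le_cst (mu : probability (borel X) R) (D : set X)
    (f : borel X -> \bar R) (m : \bar R) :
  measurable (D : set (borel X)) -> measurable_fun setT f ->
  (forall x, 0 <= f x) -> (forall x, D x -> f x <= m) ->
  \int[mu]_(x in D) f x <= m * mu D.
Proof.
move=> mD mf f0 fm; rewrite -integral_cst//; apply: ge0_le_integral => //.
exact: measurable_funS mf.
Qed.

Lemma integral_ge_cst (mu : probability (borel X) R) (D : set X)
    (f : borel X -> \bar R) (m : \bar R) :
  measurable (D : set (borel X)) -> measurable_fun setT f -> 0 <= m ->
  (forall x, 0 <= f x) -> (forall x, D x -> m <= f x) ->
  m * mu D <= \int[mu]_x f x.
Proof.
move=> mD mf m0 f0 fm.
apply: (@le_trans _ _ (\int[mu]_(x in D) f x)).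
  rewrite -integral_cst//; apply: ge0_le_integral => //.
  exact: measurable_funS mf.
exact: ge0_subset_integral.
Qed.

(** With r = t, the factor e^(C/t) becomes e^C, independent of the index, so it can be handled as a
    constant in the limits. *)
Lemma poweR_expR_scale (C r : R) (x : \bar R) : (0 < r)%R -> 0 <= x ->
  ((expR (C * r^-1))%:E * x) `^ r = (expR C)%:E * x `^ r.
Proof.
move=> r0 x0; rewrite poweRM ?lee_fin ?expR_ge0// poweR_EFin -expRM.
by rewrite divfK// gt_eqF.
Qed.

(** The space is cut into G, the part outside both G and K, and K \ G; the last piece has mass at
    most 1, which leaves m' alone. *)
Lemma integral_le_split (mu : probability (borel X) R) (G K : set X)
    (f : borel X -> \bar R) (m m' : \bar R) :
  measurable (G : set (borel X)) -> measurable (K : set (borel X)) ->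
  measurable_fun setT f -> (forall x, 0 <= f x) -> 0 <= m' ->
  (forall x, f x <= m) -> (forall x, K x -> ~ G x -> f x <= m') ->
  \int[mu]_x f x <= m * mu G + (m * mu (~` K) + m').
Proof.
move=> mG mK mf f0 m'0 fm fm'.
have mCG : measurable (~` G : set (borel X)) by exact: measurableC.
have mCK : measurable (~` K : set (borel X)) by exact: measurableC.
have m0 : 0 <= m by exact: le_trans (f0 point) (fm point).
rewrite -(setUv G) ge0_integral_setU//; last 2 first.
  by rewrite setUv.
  by apply/disj_setPCl.
apply: leeD; first exact: integral_le_cst.
have -> : ~` G = (~` G `&` ~` K) `|` (~` G `&` K) :> set (borel X).
  by rewrite -setIUr setUC setUv setIT.
rewrite ge0_integral_setU//; [|exact: measurableI|exact: measurableI| |]; last 2 first.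
  exact: measurable_funS mf.
  by apply/disj_setPS => x [[_ nKx] [_]].
apply: leeD.
  apply: le_trans (integral_le_cst _ _ mf f0 _) _; [exact: measurableI|by []|].
  apply: lee_pmul => //; rewrite ?lexx//.
  by apply: le_measure; [rewrite inE; exact: measurableI|rewrite inE|exact: subIsetr].
apply: le_trans (integral_le_cst (m := m') _ _ mf f0 _) _.
- exact: measurableI.
- by move=> x [nGx Kx]; exact: fm'.
rewrite -[leRHS]mule1; apply: lee_pmul => //.
by apply: probability_le1; exact: measurableI.
Qed.
End borel_integrals.

Lemma le_lne (R : realType) (x y : \bar R) : x <= y -> lne x <= lne y.
Proof.
move=> xy; have [x0|/ltW x0] := leP x 0; first by rewrite (le0_lneNy x0) leNye.
by rewrite lee_lne ?in_itv/= ?leey ?andbT// (le_trans x0 xy).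
Qed.

(** * The local rate along a universal net and its large deviation principle *)

Section universal_net_rate.
Context {R : realType} {X : ptopologicalType} {I : Type} {le : I -> I -> Prop}.
Context {mu : I -> probability (borel X) R} {t : I -> R}.
Hypothesis compact_measurable :
  forall K : set X, compact K -> measurable (K : set (borel X)).
Hypothesis hI : directed_set le.
Hypothesis t_gt0 : forall i, (0 < t i)%R.
Hypothesis t_cvg : t @ tails le --> (0 : R)%R.
Hypothesis mut_universal : universal_net le (fun i => (mu i, t i)).

(** Along the universal net this limsup is also the limit of mu^t(A), the quantity gam(A) of the
    introduction. *)
Definition limsup_mass (A : set X) : \bar R :=
  net_limsup le (fun i => measure_pow (mu i) (t i) A).

Definition local_mass (x : X) : \bar R :=
  ereal_inf [set limsup_mass G | G in [set G : set X | open G /\ G x]].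

Definition local_rate (x : X) : \bar R := - lne (local_mass x).

Lemma net_limsup_ge0 (u : I -> \bar R) :
  (forall i, 0 <= u i) -> 0 <= net_limsup le u.
Proof.
have FF := tails_proper hI.
move=> u0; rewrite leNgt; apply/negP => /(net_limsup_lt)/filter_ex[i].
by rewrite ltNge u0.
Qed.

Lemma limsup_mass_ge0 A : 0 <= limsup_mass A.
Proof. by apply: net_limsup_ge0 => i; exact: poweR_ge0. Qed.

Lemma limsup_mass_le1 A : measurable (A : set (borel X)) -> limsup_mass A <= 1.
Proof.
have FF := tails_proper hI.
move=> mA; apply: net_limsup_le; near=> i.
rewrite -(poweR1r (t i)); apply: poweR_le => //.
exact: probability_le1.
Unshelve. all: by end_near. Qed.

Lemma limsup_massS A B : measurable (A : set (borel X)) ->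
  measurable (B : set (borel X)) -> A `<=` B -> limsup_mass A <= limsup_mass B.
Proof.
have FF := tails_proper hI.
move=> mA mB AB; apply: net_limsupS => //; near=> i.
by apply: poweR_le => //; apply: le_measure => //; rewrite inE.
Unshelve. all: by end_near. Qed.

Lemma limsup_massU A B : measurable (A : set (borel X)) ->
  measurable (B : set (borel X)) ->
  limsup_mass (A `|` B) <= maxe (limsup_mass A) (limsup_mass B).
Proof.
by move=> mA mB; apply: limsup_pow_max => // i; exact: measureU2.
Qed.

Lemma limsup_mass0 : limsup_mass set0 = 0.
Proof.
have FF := tails_proper hI.
apply/eqP; rewrite eq_le limsup_mass_ge0 andbT; apply: net_limsup_le; near=> i.
by rewrite /measure_pow measure0 poweR0r// gt_eqF.
Unshelve. all: by end_near. Qed.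

Lemma local_mass_ge0 x : 0 <= local_mass x.
Proof. by apply: le_ereal_inf_tmp => _ [G _ <-]; exact: limsup_mass_ge0. Qed.

Lemma local_mass_le G x : open G -> G x -> local_mass x <= limsup_mass G.
Proof. by move=> oG Gx; apply: ereal_inf_lbound; exists G. Qed.

Lemma expeR_local_rate x : expeR (- local_rate x) = local_mass x.
Proof. by rewrite /local_rate oppeK lneK// in_itv/= local_mass_ge0 leey. Qed.

Lemma local_rate_gtP a x :
  (a%:E < local_rate x) = (local_mass x < (expR (- a))%:E).
Proof. by rewrite -expeR_local_rate -[(expR (- a))%:E]/(expeR (- a%:E)) lte_expeR lteN2. Qed.

Lemma local_rate_ge0 x : 0 <= local_rate x.
Proof.
rewrite oppe_ge0 lne_le0; apply: le_trans (local_mass_le openT _) _ => //.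
exact: limsup_mass_le1.
Qed.

(** An open G of small mass that witnesses the bound at x witnesses it at each of its points. *)
Lemma local_rate_lsc : lower_semicontinuous local_rate.
Proof.
move=> x a; rewrite local_rate_gtP => /ereal_inf_lt[_ [G [oG Gx] <-] ltG].
exists G; first exact: open_nbhs_nbhs.
by move=> y Gy; rewrite local_rate_gtP; apply: le_lt_trans ltG; exact: local_mass_le.
Qed.

Lemma expeR_rate_le_sup_exp (l : X -> \bar R) A x : A x ->
  expeR (- l x) <= sup_exp l A.
Proof.
by move=> Ax; rewrite le_max; apply/orP; right; apply: ereal_sup_ubound; exists x.
Qed.

Lemma sup_exp_le (l : X -> \bar R) A (d : \bar R) : 0 <= d ->
  (forall x, A x -> expeR (- l x) <= d) -> sup_exp l A <= d.
Proof.
move=> d0 h; rewrite ge_max d0/=; apply: ge_ereal_sup => _ [x Ax <-]; exact: h.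
Qed.

(** Every point has an open neighbourhood of mass below d, and maxitivity preserves this bound under
    finite unions. *)
Lemma limsup_mass_compact_lt (C : set X) (d : \bar R) : compact C -> 0 < d ->
  (forall x, C x -> local_mass x < d) -> limsup_mass C < d.
Proof.
move=> cC d0 hC.
(* Asking for an open superset makes P pass to arbitrary subsets, measurable or not. *)
pose P A := exists U : set X, [/\ open U, A `<=` U & limsup_mass U < d].
have [U [oU CU Ud]] : P C.
  apply: (compact_ind cC).
  - by exists set0; split; [exact: open0|by []|rewrite limsup_mass0].
  - by move=> A B AB [U [oU BU Ud]]; exists U; split => //; exact: subset_trans BU.
  - move=> A B [U [oU AU Ud]] [V [oV BV Vd]]; exists (U `|` V).
    split; [exact: openU|exact: setUSS|].
    by rewrite (le_lt_trans (limsup_massU _ _))// ?gt_max ?Ud//;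
      exact: open_measurable_borel.
  - move=> x /hC /ereal_inf_lt[_ [G [oG Gx] <-] ltG].
    exists G; first exact: open_nbhs_nbhs.
    by exists G; split.
apply: le_lt_trans Ud; apply: limsup_massS => //; first exact: compact_measurable.
exact: open_measurable_borel.
Qed.

Section tight.
Hypothesis tight : X0_exponentially_tight le mu t.

(** Choose K with mass of its complement below d, and cover F by F [&] K and the complement of K.
    The first set is compact and lies in [X0], which is why the supremum may be restricted to [X0];
    [local_rate_regular] relies on this. *)
Lemma limsup_mass_closed_le F : closed F ->
  limsup_mass F <= sup_exp local_rate (F `&` X0 R X).
Proof.
move=> cF; apply: le_dense_EFin => d supd.
have d0 : 0 < d%:E by apply: le_lt_trans supd; rewrite le_max lexx.
have [K [cK KX0 Kd]] := tight d0.
have mF : measurable (F : set (borel X)).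
  by rewrite -(setCK F); apply: measurableC; apply: open_measurable_borel; exact: closed_openC.
have mK := compact_measurable cK.
apply: (@le_trans _ _ (limsup_mass ((F `&` K) `|` ~` K))).
  apply: limsup_massS => //.
    by apply: measurableU; [exact: measurableI|exact: measurableC].
  by move=> x Fx; have [Kx|nKx] := pselect (K x); [left|right].
apply: le_trans (limsup_massU _ _) _; [exact: measurableI|exact: measurableC|].
rewrite ge_max (ltW Kd) andbT; apply: ltW; apply: limsup_mass_compact_lt => //.
  by rewrite setIC; exact: compact_closedI.
move=> x [Fx Kx]; apply: le_lt_trans supd; rewrite -expeR_local_rate.
by apply: expeR_rate_le_sup_exp; split => //; exact: KX0.
Qed.

Lemma local_rate_LDP : large_deviation_principle le mu t local_rate.
Proof.
split; first exact: local_rate_ge0.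
- move=> F cF; apply: le_trans (limsup_mass_closed_le cF) _.
  apply: sup_exp_le => [|x [Fx _]]; first by rewrite le_max lexx.
  exact: expeR_rate_le_sup_exp.
- move=> G oG.
  (* Only the lower bound needs universality: once the liminf is a limsup, it is [limsup_mass G],
     which dominates [local_mass] at every point of G. *)
  rewrite (universal_liminf hI mut_universal (fun p => measure_pow p.1 p.2 G)).
  apply: sup_exp_le => [|x Gx]; first exact: limsup_mass_ge0.
  by rewrite expeR_local_rate; exact: local_mass_le.
Qed.

Lemma local_rate_rate_function : rate_function le mu t local_rate.
Proof.
exists local_rate; split; first exact: local_rate_LDP.
by split => //; exact: local_rate_lsc.
Qed.

(** The complement of the closure of [X0] is an open neighbourhood of x missing every compact set
    given by tightness, so its mass is 0. *)
Lemma local_rate_out x : ~ closure (X0 R X) x -> local_rate x = +oo.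
Proof.
move=> nx; rewrite /local_rate le0_lneNy//.
pose G := ~` closure (X0 R X).
have oG : open G by apply: closed_openC; exact: closed_closure.
apply: le_trans (local_mass_le oG nx) _; apply: le_dense_EFin => d d0.
have [K [cK KX0 Kd]] := tight d0.
apply: ltW; apply: le_lt_trans Kd; apply: limsup_massS.
- exact: open_measurable_borel.
- by apply: measurableC; exact: compact_measurable.
- by apply: subsetC => y /KX0; exact: subset_closure.
Qed.

(** The powers of integrals depend on the index only through the pair (mu, t), so universality of
    the net of pairs covers them for every h at once. *)
Lemma universal_Lambda_inf h : Lambda_inf le mu t h = Lambda_sup le mu t h.
Proof.
congr lne; exact: (universal_liminf hI mut_universal
  (fun p => exp_integral_pow p.1 p.2 h)).
Qed.

Lemma universal_exp_cvg h :
  (fun i => exp_integral_pow (mu i) (t i) h) @ tails le -->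
  net_limsup le (fun i => exp_integral_pow (mu i) (t i) h).
Proof.
exact: (universal_cvg hI mut_universal
  (u := fun p => exp_integral_pow p.1 p.2 h)).
Qed.

Lemma universal_Lambda_exists h : Lambda_exists le mu t h.
Proof. by apply/cvg_ex; eexists; exact: universal_exp_cvg. Qed.

Lemma universal_Lambda h : Lambda le mu t h = Lambda_sup le mu t h.
Proof.
have FF := tails_proper hI.
congr lne; apply: cvg_lim; [exact: ereal_hausdorff|exact: universal_exp_cvg].
Qed.

Lemma Lambda_sup_homo (h h' : X -> \bar R) :
  (forall i, \int[mu i]_x expeR (h x * (t i)^-1%:E) <=
             \int[mu i]_x expeR (h' x * (t i)^-1%:E)) ->
  Lambda_sup le mu t h <= Lambda_sup le mu t h'.
Proof.
have FF := tails_proper hI.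
move=> hh'; apply: le_lne; apply: net_limsupS => //; near=> i.
apply: poweR_le => //; apply: integral_ge0 => x _; exact: expeR_ge0.
Unshelve. all: by end_near. Qed.

Lemma Lambda_truncation_homo (h : X -> R) (M N : R) : continuous h -> (M <= N)%R ->
  Lambda_sup le mu t (truncation h M) <= Lambda_sup le mu t (truncation h N).
Proof.
move=> ch MN; apply: Lambda_sup_homo => i.
have ti : (0 < (t i)^-1)%R by rewrite invr_gt0.
apply: ge0_le_integral => //.
- by move=> x _; exact: expeR_ge0.
- exact: measurable_expeR_truncation.
- exact: measurable_expeR_truncation.
- move=> x _; rewrite lee_expeR; apply: lee_wpmul2r; first by rewrite lee_fin ltW.
  rewrite /truncation; case: ifPn => [hM|_]; last by rewrite leNye.
  by rewrite (lt_le_trans hM MN).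
Qed.

Lemma Lambda_truncation_le (h : X -> R) (M : R) : continuous h ->
  Lambda_sup le mu t (truncation h M) <= Lambda_sup le mu t (EFin \o h).
Proof.
move=> ch; apply: Lambda_sup_homo => i.
have ti : (0 < (t i)^-1)%R by rewrite invr_gt0.
apply: ge0_le_integral => //.
- by move=> x _; exact: expeR_ge0.
- exact: measurable_expeR_truncation.
- exact: measurable_expR_scale.
- move=> x _; rewrite lee_expeR; apply: lee_wpmul2r; first by rewrite lee_fin ltW.
  by rewrite /truncation; case: ifP => //= _; rewrite leNye.
Qed.

Lemma expeR_lne_limsup (u : I -> \bar R) : (forall i, 0 <= u i) ->
  expeR (lne (net_limsup le u)) = net_limsup le u.
Proof. by move=> u0; rewrite lneK// in_itv/= leey andbT; exact: net_limsup_ge0. Qed.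

Lemma sub_rate_le_Lambda_truncation (h : X -> R) (M : R) x :
  continuous h -> (h x < M)%R ->
  (h x)%:E - local_rate x <= Lambda_sup le mu t (truncation h M).
Proof.
have FF := tails_proper hI.
move=> ch hxM; apply/lee_addgt0Pr => e e0.
(* The slack e is absorbed into a = h(x) - e, so that a < h holds on an open set containing x. *)
have -> : (h x)%:E - local_rate x = (h x - e)%:E - local_rate x + e%:E.
  by rewrite addeAC -EFinD subrK.
apply: leeD2r; rewrite -lee_expeR expeR_lne_limsup; last first.
  by move=> i; exact: poweR_ge0.
rewrite expeRD expeR_local_rate /=; set a := (h x - e)%R.
pose G := h @^-1` [set r | (a < r < M)%R].
have oG : open G.
  have -> : G = h @^-1` `]a, M[%classic by apply/seteqP; split => y; rewrite /G/= in_itv.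
  by move/continuousP : ch; apply; exact: interval_open.
have Gx : G x by rewrite /G/= hxM andbT /a; lra.
have mG := open_measurable_borel oG.
have expK (m : \bar R) : (expR (- a))%:E * ((expR a)%:E * m) = m.
  by rewrite muleA -EFinM -expRD addNr expR0 mul1e.
apply: le_dense_EFin => d /net_limsup_lt ltd.
(* It suffices to bound the mass of G, since x is in G. The factor e^(-a) compensates the lower
   bound e^(a/t) of the integrand on G after taking the power t. *)
suff Gd : limsup_mass G <= (expR (- a))%:E * d%:E.
  apply: (@le_trans _ _ ((expR a)%:E * ((expR (- a))%:E * d%:E))).
    rewrite lee_pmul2l ?lte_fin ?expR_gt0//.
    exact: le_trans (local_mass_le oG Gx) Gd.
  by rewrite -!EFinM mulrA -expRD subrr expR0 mul1r.
apply: net_limsup_le; apply: filterS ltd => i /ltW led.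
rewrite -[leLHS](expK); apply: lee_pmul => //; rewrite ?lee_fin ?expR_ge0//.
  by rewrite mule_ge0 ?lee_fin ?expR_ge0 ?poweR_ge0.
apply: le_trans led.
rewrite /measure_pow -poweR_expR_scale//; apply: poweR_le => //.
  by rewrite mule_ge0 ?lee_fin ?expR_ge0.
have ti : (0 < (t i)^-1)%R by rewrite invr_gt0.
apply: integral_ge_cst => //.
- exact: measurable_expeR_truncation.
- by move=> y; exact: expeR_ge0.
- move=> y /andP[ay yM]; rewrite expeR_truncation// yM lee_fin ler_expR.
  by rewrite ler_pM2r// ltW.
Qed.

(** On G and off K the integrand is at most e^(C/t), and the small mass brings in the factor e^(-c);
    on K \ G the function itself is at most C - c. Two uses of [limsup_pow_max] reduce the sum of
    the three terms to their maximum. *)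
Lemma Lambda_le_peak (G K : set X) (h : X -> R) (C c : R) :
  open G -> compact K -> continuous h -> (forall y, (h y <= C)%R) ->
  (forall y, K y -> ~ G y -> (h y <= C - c)%R) ->
  limsup_mass G < (expR (- c))%:E -> limsup_mass (~` K) < (expR (- c))%:E ->
  Lambda_sup le mu t (EFin \o h) <= (C - c)%:E.
Proof.
have FF := tails_proper hI.
move=> oG cK ch hC hc Gc Kc.
rewrite -lee_expeR expeR_lne_limsup; last by move=> i; exact: poweR_ge0.
pose m i : \bar R := (expR (C * (t i)^-1))%:E.
have m0 i : 0 <= m i by rewrite lee_fin expR_ge0.
pose m' i : \bar R := (expR ((C - c) * (t i)^-1))%:E.
have m'0 i : 0 <= m' i by rewrite lee_fin expR_ge0.
have ti i : (0 < (t i)^-1)%R by rewrite invr_gt0.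
have mass_le (A : set X) : limsup_mass A < (expR (- c))%:E ->
    net_limsup le (fun i => (m i * mu i A) `^ t i) <= (expR (C - c))%:E.
  move=> Ac; apply: net_limsup_le; apply: filterS (net_limsup_lt Ac) => i /ltW led.
  by rewrite poweR_expR_scale// expRD EFinM; apply: lee_pmul; rewrite ?lee_fin ?expR_ge0 ?poweR_ge0.
apply: le_trans (limsup_pow_max hI t_gt0 t_cvg
  (a := fun i => m i * mu i G) (b := fun i => m i * mu i (~` K) + m' i) _ _ _ _) _.
- by move=> i; rewrite mule_ge0.
- by move=> i; rewrite adde_ge0// mule_ge0.
- by move=> i; apply: integral_ge0 => x _; exact: expeR_ge0.
- move=> i; apply: integral_le_split => //.
  + exact: open_measurable_borel.
  + exact: compact_measurable.
  + exact: measurable_expR_scale.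
  + by move=> x; exact: expeR_ge0.
  + by move=> x; rewrite /= lee_fin ler_expR ler_pM2r.
  + by move=> x Kx nGx; rewrite /= lee_fin ler_expR ler_pM2r// hc.
rewrite ge_max mass_le//=.
apply: le_trans (limsup_pow_max hI t_gt0 t_cvg
  (a := fun i => m i * mu i (~` K)) (b := m') _ _ _ _) _ => //.
- by move=> i; rewrite mule_ge0.
- by move=> i; rewrite adde_ge0// mule_ge0.
rewrite ge_max mass_le//=; apply: net_limsup_le; near=> i.
by rewrite lee_fin -expRM divfK// gt_eqF.
Unshelve. all: by end_near. Qed.

Lemma lee_subl_swap (r : R) (x y : \bar R) :
  0 <= x -> r%:E - x <= y -> r%:E - y <= x.
Proof.
move: x y => [x| |] [y| |]//=; rewrite ?leNye ?leey//.
by rewrite -!EFinB !lee_fin => _; lra.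
Qed.

Section peak_rate.
Context {T D : set (X -> R)} {x : X} {a : R}.
Hypotheses (TD : peak_family x T D) (xa : a%:E < local_rate x).

Lemma peak_rate :
  exists2 h, T h & a%:E <= (h x)%:E - Lambda_sup le mu t (EFin \o h).
Proof.
move: xa; rewrite local_rate_gtP => /ereal_inf_lt[_ [G [oG Gx] <-] ltG].
have ea0 : (0 < expR (- a))%R by exact: expR_gt0.
have [K [cK _ Ka]] := tight ea0.
have cKG : compact (K `&` ~` G) by apply: compact_closedI => //; exact: open_closedC.
have [f Df fKG] := compact_peak a TD cKG (fun h => h.2 Gx).
have [_ Dprop _ _ DT] := TD.
have [cf f0 fx] := Dprop _ Df; have [C TC] := DT _ Df.
exists (fun y => f y + C)%R => //; rewrite fx add0r.
(* The value at x is C and [Lambda_sup] is at most C - a, so the unknown constant C cancels. *)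
apply: (@le_trans _ _ (C%:E - (C - a)%:E)).
  by rewrite -EFinB lee_fin; lra.
apply: leeD2l; rewrite leeN2; apply: (Lambda_le_peak oG cK) => //.
- by move=> y; apply: cvgD; [exact: cf|exact: cvg_cst].
- by move=> y; have := f0 y; lra.
- by move=> y Ky nGy; have := fKG y (conj Ky nGy); lra.
Qed.

End peak_rate.

(** Truncations increase with M, so the limit exists and is the supremum. *)
Lemma truncation_cvg (h : X -> R) : continuous h ->
  Lambda_inf le mu t (truncation h M) @[M --> +oo%R] -->
  ereal_sup (range (fun M : R => Lambda_sup le mu t (truncation h M))).
Proof.
move=> ch; under eq_fun do rewrite universal_Lambda_inf.
by apply: nondecreasing_cvge => M N; exact: Lambda_truncation_homo.
Qed.

Lemma rate_formula_peaks (T A : set (X -> R)) : T `<=` A ->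
  (forall h, A h -> continuous h) ->
  (forall x, exists D, peak_family x T D) ->
  rate_formula le mu t T A local_rate.
Proof.
move=> TA Acont TD; split.
- by move=> h _; exact: universal_Lambda_exists.
- by move=> h /Acont/truncation_cvg H; apply/cvg_ex; eexists; exact: H.
move=> x _.
pose L h := ereal_sup (range (fun M : R => Lambda_sup le mu t (truncation h M))).
(* All four suprema are treated at once. Each functional Phi lies between L and [Lambda_sup]: the
   bound by L gives h(x) - Phi(h) at most the rate, and the bound by [Lambda_sup] lets peak
   functions in [T] approach it. *)
have sandwich (D : set (X -> R)) (Phi : (X -> R) -> \bar R) :
    T `<=` D -> D `<=` A ->
    (forall h, A h -> L h <= Phi h <= Lambda_sup le mu t (EFin \o h)) ->
    local_rate x = ereal_sup [set (h x)%:E - Phi h | h in D].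
  move=> TD' DA LPhi; apply/eqP; rewrite eq_le; apply/andP; split.
    apply: le_dense_EFin => d supd; rewrite leNgt; apply/negP => dJ.
    have [E peakE] := TD x; have [h Th dh] := peak_rate peakE dJ.
    move: supd; rewrite ltNge => /negP; apply; apply: (le_trans dh).
    apply: le_ereal_sup_tmp; exists ((h x)%:E - Phi h); first by exists h => //; exact: TD'.
    by apply: leeD2l; rewrite leeN2; case/andP: (LPhi _ (TA _ Th)).
  apply: ge_ereal_sup => _ [h /DA Ah <-].
  apply: lee_subl_swap; first exact: local_rate_ge0.
  case/andP: (LPhi _ Ah) => + _; apply: le_trans.
  (* Any truncation level above h(x) would do; h(x) + 1 is one. *)
  apply: le_ereal_sup_tmp; exists (Lambda_sup le mu t (truncation h (h x + 1))).
    by exists (h x + 1)%R.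
  by apply: sub_rate_le_Lambda_truncation; [exact: Acont|rewrite ltrDl].
have L_le h : A h -> L h <= Lambda_sup le mu t (EFin \o h).
  by move=> /Acont ch; apply: ge_ereal_sup => _ [M _ <-]; exact: Lambda_truncation_le.
split; apply: sandwich => // h Ah.
- by rewrite universal_Lambda L_le/=.
- by rewrite L_le/=.
- by rewrite universal_Lambda_inf L_le/=.
- by rewrite (cvg_lim _ (truncation_cvg (Acont _ Ah)))// lexx L_le.
Qed.

(** * Regular spaces: recovery from [X0] and uniqueness *)

Section regular.
Hypothesis regX : regular_space X.

Lemma regular_open_closure (G : set X) x : open G -> G x ->
  exists V : set X, [/\ open V, V x & closure V `<=` G].
Proof.
move=> oG Gx; have [U xU clU] := regX (open_nbhs_nbhs (conj oG Gx)).
exists U^°; split; [exact: open_interior|exact: xU|].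
by apply: subset_trans clU; apply: closureS; exact: interior_subset.
Qed.

Lemma local_mass_closure_le (V : set X) x : open V -> V x ->
  local_mass x <= limsup_mass (closure V).
Proof.
move=> oV Vx; apply: le_trans (local_mass_le oV Vx) _; apply: limsup_massS.
- exact: open_measurable_borel.
- rewrite -(setCK (closure V)); apply: measurableC; apply: open_measurable_borel.
  by apply: closed_openC; exact: closed_closure.
- exact: subset_closure.
Qed.

(** One inequality is lower semicontinuity. For the other, regularity puts the closure of an open V
    containing x inside G, and the upper bound for closed sets involves only points of [X0]. *)
Lemma local_rate_regular x : local_rate x = ereal_sup
  [set ereal_inf [set local_rate y | y in G `&` X0 R X]
  | G in [set G : set X | open G /\ G x]].
Proof.
apply/eqP; rewrite eq_le; apply/andP; split.
  apply: le_dense_EFin => d supd; rewrite leNgt; apply/negP => dJ.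
  move: supd; rewrite ltNge => /negP; apply.
  have [W xW Wd] := local_rate_lsc dJ.
  apply: le_ereal_sup_tmp.
  exists (ereal_inf [set local_rate y | y in W^° `&` X0 R X]).
    by exists W^° => //; split; [exact: open_interior|exact: xW].
  by apply: le_ereal_inf_tmp => _ [y [/interior_subset/Wd/ltW ? _] <-].
apply: ge_ereal_sup => _ [G [oG Gx] <-].
have [V [oV Vx clV]] := regular_open_closure oG Gx.
rewrite -leeN2 -lee_expeR expeR_local_rate.
apply: le_trans (local_mass_closure_le oV Vx) _.
apply: le_trans (limsup_mass_closed_le (@closed_closure _ V)) _.
apply: sup_exp_le => [|y [/clV Gy X0y]]; first exact: expeR_ge0.
by rewrite lee_expeR leeN2; apply: ereal_inf_lbound; exists y.
Qed.

(** The lower bound on open sets gives [local_rate] below l, hence below its regularization J.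
    Conversely, if J > d near x, the upper bound on a closed neighbourhood contained there gives
    [local_rate] at least d at x. *)
Lemma rate_function_unique (J : X -> \bar R) :
  rate_function le mu t J -> forall x, J x = local_rate x.
Proof.
move=> [l [[l0 lup llow] [Jlsc Jl Jmax]]] x; apply/eqP; rewrite eq_le.
apply/andP; split; last first.
  apply: Jmax; first exact: local_rate_lsc.
  move=> {}x; rewrite -leeN2 -lee_expeR expeR_local_rate.
  apply: le_ereal_inf_tmp => _ [G [oG Gx] <-].
  apply: le_trans (expeR_rate_le_sup_exp _ Gx) _; apply: le_trans (llow _ oG) _.
  exact: net_liminf_le_limsup.
apply: le_dense_EFin => d Jd; rewrite leNgt; apply/negP => dJ.
have [W xW Wd] := Jlsc _ _ dJ.
have [V [oV Vx clV]] := regular_open_closure (@open_interior _ W) xW.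
move: Jd; rewrite ltNge => /negP; apply.
rewrite -leeN2 -lee_expeR expeR_local_rate.
apply: le_trans (local_mass_closure_le oV Vx) _.
apply: le_trans (lup _ (@closed_closure _ V)) _.
apply: sup_exp_le => [|y /clV/interior_subset/Wd dy]; first exact: expeR_ge0.
by rewrite lee_expeR leeN2; exact: le_trans (ltW dy) (Jl y).
Qed.

End regular.

End tight.
End universal_net_rate.

(** * Passage to the subnet and conclusion *)

Lemma X0_exponentially_tight_subnet (R : realType) (X : ptopologicalType)
    (I : Type) (le : I -> I -> Prop) (mu : I -> probability (borel X) R)
    (t : I -> R) (B : Type) (leB : B -> B -> Prop) (phi : B -> I) :
  subnet_map le leB phi -> X0_exponentially_tight le mu t ->
  X0_exponentially_tight leB (mu \o phi) (t \o phi).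
Proof.
move=> sub tight eps /tight[K [cK KX0 Keps]]; exists K; split => //.
by apply: le_lt_trans Keps; exact: (subnet_limsup (phi := phi) _ sub).
Qed.

Theorem corollary2 (R : realType) (X : ptopologicalType)
    (hX : exists x y : X, x <> y)
    (hcompact : forall K : set X, compact K -> measurable (K : set (borel X)))
    (I : Type) (le : I -> I -> Prop) (hI : directed_set le)
    (mu : I -> probability (borel X) R) (t : I -> R)
    (ht_pos : forall i, (0 < t i)%R)
    (ht_cvg : t @ tails le --> (0 : R)%R)
    (htight : X0_exponentially_tight le mu t)
    (hsep : separates_points [set h : X -> R | continuous h]) :
  exists (B : Type) (leB : B -> B -> Prop) (phi : B -> I),
    subnet_map le leB phi /\
    forall A : set (X -> R),
      (function_algebra A /\ separates_points A) \/ well_separating_class A ->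
      exists J : X -> \bar R,
        [/\ rate_function leB (mu \o phi) (t \o phi) J,
            forall x, ~ closure (X0 R X) x -> J x = +oo,
            rate_formula leB (mu \o phi) (t \o phi) (bounded_above A) A J,
            regular_space X ->
              (forall x, J x = ereal_sup
                 [set ereal_inf [set J y | y in G `&` X0 R X]
                 | G in [set G : set X | open G /\ G x]]) /\
              (forall J' : X -> \bar R,
                 rate_function leB (mu \o phi) (t \o phi) J' ->
                 rate_formula leB (mu \o phi) (t \o phi)
                   (bounded_above A) A J' ->
                 forall x, J' x = J x) &
            nowhere_vanishing A ->
              rate_formula leB (mu \o phi) (t \o phi) (nonpositive A) A J].
Proof.
(* The subnet is fixed before [A] is introduced, so the same one serves every class. *)
have [B [leB [phi [sub univ]]]] := universal_subnet hI.
exists B, leB, phi; split => // A HA.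
have [hB _] := sub.
have tB : (t \o phi) @ tails leB --> (0 : R)%R.
  by apply: cvg_trans ht_cvg => P /(subnet_tails sub).
have tB_pos b : (0 < (t \o phi) b)%R by exact: ht_pos.
(* Universality of [phi] passes to any function of the index by taking preimages. *)
have univB : universal_net leB (fun b => ((mu \o phi) b, (t \o phi) b)).
  by move=> P; exact: (univ [set i | P (mu i, t i)]).
have tightB := X0_exponentially_tight_subnet sub htight.
have Acont h : A h -> continuous h.
  by case: HA => [[Aalg _]|Awsc]; [case: Aalg => + _ _ _ _|case: Awsc => + _ _ _]; exact.
exists (local_rate (le := leB) (mu := mu \o phi) (t := t \o phi)); split.
- exact: local_rate_rate_function.
- exact: local_rate_out.
- apply: rate_formula_peaks => // [h []//|x].
  case: HA => [[Aalg Asep]|Awsc].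
    by exists (shifted_at x A); exact: algebra_peak_bounded_above.
  exists (nonpositive_at x A); apply: peak_familyS (well_separating_peak x Awsc).
  by move=> h [Ah h0]; split => //; exists 0%R.
- move=> regX; split; first exact: local_rate_regular.
  by move=> J' rJ' _; exact: rate_function_unique.
- move=> Anv; apply: rate_formula_peaks => // [h []//|x].
  exists (nonpositive_at x A); case: HA => [[Aalg Asep]|Awsc].
    exact: algebra_peak_nonpositive.
  exact: well_separating_peak.
Qed.
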